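(* Let $V$, $W$ be two finite-dimensional diffeological vector spaces. Then $\dim((V\otimes W)^* )=\dim(V^* )\cdot\dim(W^* )$, where $^*$ denotes the diffeological dual and $V\otimes W$ carries the tensor product diffeology.
   Context: A diffeological space is a set $X$ with a collection of maps (plots) $U\to X$, for $U$ open in $\mathbb{R}^n$, $n\in\mathbb{N}$, such that: constant maps are plots; the composition of a plot with an ordinary smooth map between open sets of Euclidean spaces is a plot; a map that is locally a plot is a plot. A map $f:X\to Y$ is smooth if $f\circ p$ is a plot of $Y$ for every plot $p$ of $X$. A diffeological vector space is a real vector space with a diffeology for which addition and scalar multiplication are smooth (such a diffeology is called a vector space diffeology; products carry the product diffeology, i.e. the coarsest one making the projections smooth, and $\mathbb{R}$ its standard diffeology). A diffeology is finer than another if it is contained in it. The diffeological dual $V^*$ of $V$ is the vector space of all smooth linear maps $V\to\mathbb{R}$, endowed with the functional diffeology. The tensor product $V\otimes W$ is the usual tensor product of vector spaces, regarded as a quotient of the free real vector space on the set $V\times W$; its tensor product diffeology is the quotient diffeology of the finest vector space diffeology on that free vector space which contains the product diffeology of $V\times W$ (a map into a quotient $X/\sim$ is a plot of the quotient diffeology iff it locally lifts to a plot of $X$). Equivalently, it has the universal property that smooth linear maps $V\otimes W\to Z$ correspond to smooth bilinear maps $V\times W\to Z$ for every diffeological vector space $Z$. *)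

(* Defs.v *)
From HB Require Import structures.
From mathcomp Require Import all_boot all_order all_algebra.
From mathcomp Require Import all_classical reals interval_inference topology normedtype landau derive.
From mathcomp Require Import freeg.

Set Implicit Arguments.
Unset Strict Implicit.
Unset Printing Implicit Defensive.

Import Order.TTheory GRing.Theory Num.Theory numFieldNormedType.Exports.

Local Open Scope classical_set_scope.
Local Open Scope ring_scope.
Local Open Scope quotient_scope.

Section Smooth.
Context {R : realType}.

(* [differentiable] is Frechet differentiability; when [U] is open, [Ck k U f]
   only depends on the restriction of [f] to [U] (see [eq_Ck]). *)
Fixpoint Ck {E F : normedModType R} (k : nat) (U : set E) (f : E -> F) : Prop :=
  if k is k'.+1 then
    (forall x, U x -> differentiable f x) /\ (forall v, Ck k' U ('D_v f))
  else forall x, U x -> {for x, continuous f}.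

Definition smooth_on {E F : normedModType R} (U : set E) (f : E -> F) : Prop :=
  forall k, Ck k U f.

Implicit Types E F : normedModType R.

Lemma near0_differentiable E F (h : E -> F) (x : E) :
  (\forall y \near x, h y = 0) -> differentiable h x.
Proof.
move=> h0.
have cont0 : continuous (\0 : E -> F) by exact: cst_continuous.
have lin : h \o shift x = cst (h x) + (\0 : {linear E -> F}) +o_ 0 id.
  apply/eqaddoP => _/posnumP[e].
  have : \forall y \near (0 : E), h (y + x) = 0.
    by move: h0; rewrite (near_shift 0 x) /=; apply: filterS => y; rewrite subr0.
  apply: filterS => y /= hy; rewrite !fctE /= hy (nbhs_singleton h0).
  by rewrite addr0 subr0 normr0 mulr_ge0.
by apply/diff_locallyP; rewrite (diff_unique cont0 lin).
Qed.

Lemma near_eq_differentiable E F (f g : E -> F) (x : E) :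
  (\forall y \near x, f y = g y) -> differentiable f x -> differentiable g x.
Proof.
move=> fg df; have -> : g = f + (g - f) by apply/funext => y; rewrite !fctE addrC subrK.
apply: differentiableD => //; apply: near0_differentiable.
by apply: filterS fg => y fgy; rewrite !fctE fgy subrr.
Qed.

Lemma eq_Ck E F k (U : set E) (f g : E -> F) :
  open U -> (forall x, U x -> f x = g x) -> Ck k U f -> Ck k U g.
Proof.
move=> oU; elim: k f g => [|k IH] f g fg /=.
  move=> fc x Ux; rewrite /prop_for /continuous_at -(fg _ Ux).
  apply: cvg_trans (fc x Ux); apply: near_eq_cvg.
  by apply: filterS (open_nbhs_nbhs (conj oU Ux)) => y /fg.
move=> [df Df]; split=> [x Ux|v].
  apply: near_eq_differentiable (df x Ux).
  by apply: filterS (open_nbhs_nbhs (conj oU Ux)) => y /fg.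
apply: IH (Df v) => x Ux; apply: near_eq_derive.
by apply: filterS (open_nbhs_nbhs (conj oU Ux)) => y /fg.
Qed.

Lemma CkW E F k (U : set E) (f : E -> F) : Ck k.+1 U f -> Ck k U f.
Proof.
elim: k f => [|k IH] f /=.
  by move=> [df _] x /df; exact: differentiable_continuous.
by move=> [df Df]; split=> // v; apply: IH; exact: Df.
Qed.

Lemma Ck_sub E F k (U U' : set E) (f : E -> F) : U' `<=` U -> Ck k U f -> Ck k U' f.
Proof.
move=> sU; elim: k f => [|k IH] f /=; first by move=> fc x /sU /fc.
by move=> [df Df]; split=> [x /sU /df//|v]; apply: IH.
Qed.

Lemma Ck_cst E F k (U : set E) (c : F) : Ck k U (cst c : E -> F).
Proof.
elim: k c => [|k IH] c /=; first by move=> x _; exact: cst_continuous.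
split=> [x _|v]; first exact: differentiable_cst.
have -> : 'D_v (cst c : E -> F) = cst 0 by apply/funext => x; exact: derive_cst.
exact: IH.
Qed.

Lemma CkD E F k (U : set E) (f g : E -> F) :
  open U -> Ck k U f -> Ck k U g -> Ck k U (f + g).
Proof.
move=> oU; elim: k f g => [|k IH] f g /=.
  by move=> cf cg x Ux; apply: continuousD; [exact: cf|exact: cg].
move=> [df Df] [dg Dg]; split=> [x Ux|v].
  by apply: differentiableD; [exact: df|exact: dg].
apply: eq_Ck (IH _ _ (Df v) (Dg v)) => // x Ux.
by rewrite deriveD //; apply: diff_derivable; [exact: df|exact: dg].
Qed.

Lemma CkM E k (U : set E) (f g : E -> R) :
  open U -> Ck k U f -> Ck k U g -> Ck k U (f * g).
Proof.
move=> oU; elim: k f g => [|k IH] f g.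
  by move=> cf cg x Ux; apply: continuousM; [exact: cf|exact: cg].
move=> Cf Cg; move: (Cf) (Cg) => [df Df] [dg Dg]; split=> [x Ux|v].
  by apply: differentiableM; [exact: df|exact: dg].
apply: eq_Ck (CkD oU (IH _ _ (CkW Cf) (Dg v)) (IH _ _ (CkW Cg) (Df v))) => // x Ux.
by rewrite deriveM //; apply: diff_derivable; [exact: df|exact: dg].
Qed.

Lemma Ck_sum E F k (U : set E) n (f : 'I_n -> E -> F) :
  open U -> (forall i, Ck k U (f i)) -> Ck k U (\sum_i f i).
Proof.
move=> oU Cf; elim/big_ind: _ => // [|g h Cg Ch]; first exact: Ck_cst.
exact: CkD.
Qed.

Lemma Ck_coord E k (U : set E) n (h : E -> 'rV[R]_n) (j : 'I_n) :
  open U -> Ck k U h -> Ck k U (fun x => h x 0 j).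
Proof.
move=> oU; elim: k h => [|k IH] h /=.
  move=> hc x Ux; apply: (@continuous_comp _ _ _ h (fun M : 'rV_n => M 0 j)).
    exact: hc.
  exact: coord_continuous.
move=> [dh Dh]; split=> [x Ux|v].
  apply: (@differentiable_comp _ _ _ _ h (fun M : 'rV_n => M 0 j)).
    exact: dh.
  exact: differentiable_coord.
apply: eq_Ck (IH _ (Dh v)) => // x Ux.
by rewrite derive_mx ?mxE//; apply: diff_derivable; exact: dh.
Qed.

Lemma Ck_comp E k n (U : set E) (U' : set 'rV[R]_n) (h : E -> 'rV[R]_n)
    (f : 'rV[R]_n -> R) :
  open U -> h @` U `<=` U' -> Ck k U h -> Ck k U' f -> Ck k U (f \o h).
Proof.
move=> oU hU; elim: k f => [|k IH] f.
  move=> hc fc x Ux; apply: continuous_comp; first exact: hc.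
  by apply: fc; apply: hU; exists x.
move=> Ch; move: (Ch) => [dh Dh] [df Df].
have hU' x : U x -> U' (h x) by move=> Ux; apply: hU; exists x.
split=> [x Ux|v].
  by apply: differentiable_comp; [exact: dh|exact/df/hU'].
pose g := \sum_(j < n) (fun x => 'D_v h x 0 j) * ('D_(delta_mx 0 j) f \o h).
apply: (@eq_Ck _ _ _ _ g) => //; last first.
  apply: Ck_sum => // j; apply: CkM => //; first exact: Ck_coord (Dh v).
  by apply: IH; [exact: CkW|exact: Df].
move=> x Ux; have dhx := dh x Ux; have dfx := df _ (hU' _ Ux).
rewrite deriveE; last exact: differentiable_comp.
rewrite diff_comp //= -(deriveE v dhx) [X in 'd f _ X]row_sum_delta linear_sum /=.
rewrite /g fct_sumE; apply: eq_bigr => j _.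
by rewrite linearZ /= -(deriveE _ dfx).
Qed.

End Smooth.

Record diffeology (R : realType) (X : Type) := Diffeology {
  (* a plot with domain [U] is represented by a total function on R^n that only
     matters on [U] *)
  plot : forall n : nat, set 'rV[R]_n -> ('rV[R]_n -> X) -> Prop;
  plot_open : forall n (U : set 'rV[R]_n) (p : 'rV[R]_n -> X),
    plot U p -> open U;
  plot_ext : forall n (U : set 'rV[R]_n) (p q : 'rV[R]_n -> X),
    (forall u, U u -> p u = q u) -> plot U p -> plot U q;
  plot_cst : forall n (U : set 'rV[R]_n) (x : X),
    open U -> plot U (fun=> x);
  plot_comp : forall m n (U : set 'rV[R]_n) (U' : set 'rV[R]_m)
      (p : 'rV[R]_n -> X) (h : 'rV[R]_m -> 'rV[R]_n),
    plot U p -> open U' -> smooth_on U' h -> h @` U' `<=` U ->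
    plot U' (p \o h);
  plot_local : forall n (U : set 'rV[R]_n) (p : 'rV[R]_n -> X),
    open U ->
    (forall u, U u -> exists U', [/\ U' u, U' `<=` U & plot U' p]) ->
    plot U p
}.

Arguments plot {R X} d {n} U p.

Section Diffeologies.
Context {R : realType}.

Definition smooth {X Y : Type} (DX : diffeology R X) (DY : diffeology R Y)
    (f : X -> Y) : Prop :=
  forall n (U : set 'rV[R]_n) (p : 'rV[R]_n -> X),
    plot DX U p -> plot DY U (f \o p).

Definition finer {X : Type} (D D' : diffeology R X) : Prop :=
  forall n (U : set 'rV[R]_n) (p : 'rV[R]_n -> X), plot D U p -> plot D' U p.

Lemma plot_sub {X : Type} (D : diffeology R X) n (U U' : set 'rV[R]_n) p :
  open U' -> U' `<=` U -> plot D U p -> plot D U' p.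
Proof.
move=> oU' sU Up; apply: (@plot_comp _ _ D _ _ U U' p id) => //; last first.
  by move=> _ [x /sU Ux <-].
have Did k (v : 'rV[R]_n) : Ck k U' ('D_v (fun x : 'rV[R]_n => x)).
  apply: (@eq_Ck _ _ _ _ _ (cst v)) => //; last exact: Ck_cst.
  by move=> x _; rewrite derive_id.
case=> [|k]; first by move=> x _; exact: cvg_id.
by split=> [x _|v]; [exact: ex_diff|exact: Did].
Qed.

Definition std_plot n (U : set 'rV[R]_n) (p : 'rV[R]_n -> R) : Prop :=
  open U /\ smooth_on U p.

Program Definition std_diffeology : diffeology R R :=
  @Diffeology R R std_plot _ _ _ _ _.
Next Obligation. by move=> n U p []. Qed.
Next Obligation. by move=> n U p q pq [oU sp]; split=> // k; exact: eq_Ck (sp k). Qed.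
Next Obligation. by move=> n U x oU; split=> // k; exact: Ck_cst. Qed.
Next Obligation.
move=> m n U U' p h [oU sp] oU' sh hU; split=> // k.
exact: Ck_comp hU (sh k) (sp k).
Qed.
Next Obligation.
move=> n U p oU loc; split=> // k.
suff : forall x, U x -> exists2 U', U' x & Ck k U' p.
  elim: k p {loc} => [|k IH] p /=.
    by move=> loc x Ux; have [U' U'x] := loc x Ux; apply.
  move=> loc; split=> [x Ux|v].
    by have [U' U'x [dp _]] := loc x Ux; exact: dp.
  by apply: IH => x Ux; have [U' U'x [_ Dp]] := loc x Ux; exists U'.
by move=> x Ux; have [U' [U'x _ [_ sp]]] := loc x Ux; exists U'.
Qed.

Definition prod_plot {X Y : Type} (DX : diffeology R X) (DY : diffeology R Y)
    n (U : set 'rV[R]_n) (p : 'rV[R]_n -> X * Y) : Prop :=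
  plot DX U (fst \o p) /\ plot DY U (snd \o p).

Program Definition prod_diffeology {X Y : Type}
    (DX : diffeology R X) (DY : diffeology R Y) : diffeology R (X * Y) :=
  @Diffeology R (X * Y) (prod_plot DX DY) _ _ _ _ _.
Next Obligation. by move=> X Y DX DY n U p [] /plot_open. Qed.
Next Obligation.
move=> X Y DX DY n U p q pq [p1 p2]; split.
  by apply: plot_ext p1 => u /pq /= ->.
by apply: plot_ext p2 => u /pq /= ->.
Qed.
Next Obligation. by move=> X Y DX DY n U [x y] oU; split; exact: plot_cst. Qed.
Next Obligation.
move=> X Y DX DY m n U U' p h [p1 p2] oU' sh hU.
by split; [exact: plot_comp p1 _ _ _|exact: plot_comp p2 _ _ _].
Qed.
Next Obligation.
move=> X Y DX DY n U p oU loc; split; apply: plot_local => // u /loc.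
  by move=> [U' [? ? []]]; exists U'.
by move=> [U' [? ? []]]; exists U'.
Qed.

Lemma prod_diffeology_coarsest {X Y : Type}
    (DX : diffeology R X) (DY : diffeology R Y) :
  [/\ smooth (prod_diffeology DX DY) DX fst,
      smooth (prod_diffeology DX DY) DY snd &
      forall D, smooth D DX fst -> smooth D DY snd ->
        finer D (prod_diffeology DX DY)].
Proof.
split=> [n U p []//|n U p []//|D s1 s2 n U p Up].
by split; [exact: s1|exact: s2].
Qed.

Definition quotient_plot {X Y : Type} (DX : diffeology R X) (pi : X -> Y)
    n (U : set 'rV[R]_n) (q : 'rV[R]_n -> Y) : Prop :=
  open U /\ forall u, U u -> exists U' (p : 'rV[R]_n -> X),
    [/\ U' u, U' `<=` U, plot DX U' p & forall v, U' v -> q v = pi (p v)].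

(* constant maps lift because [pi] is onto *)
Program Definition quotient_diffeology {X Y : Type} (DX : diffeology R X)
    (pi : X -> Y) (pi_surj : forall y, exists x, pi x = y) : diffeology R Y :=
  @Diffeology R Y (quotient_plot DX pi) _ _ _ _ _.
Next Obligation. by move=> X Y DX pi pi_surj n U p []. Qed.
Next Obligation.
move=> X Y DX pi pi_surj n U p q pq [oU lft]; split=> // u /lft.
move=> [U' [p' [U'u sU' pp' e]]]; exists U', p'; split=> // v U'v.
by rewrite -e// pq//; exact: sU'.
Qed.
Next Obligation.
move=> X Y DX pi pi_surj n U y oU; split=> // u Uu.
have [x <-] := pi_surj y.
by exists U, (fun=> x); split=> //; exact: plot_cst.
Qed.
Next Obligation.
move=> X Y DX pi pi_surj m n U U' q h [oU lft] oU' sh hU; split=> // u U'u.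
have [V [p [Vhu sV Vp e]]] := lft (h u) (hU _ (ex_intro2 _ _ u U'u erefl)).
have hc x : U' x -> {for x, continuous h} by exact: (sh 0%N).
have oW : open (U' `&` h @^-1` V).
  rewrite openE => x [U'x Vhx]; apply: filterI.
    exact: open_nbhs_nbhs.
  apply: (hc x U'x); apply: open_nbhs_nbhs; split=> //; exact: plot_open Vp.
exists (U' `&` h @^-1` V), (p \o h); split=> //; last by move=> v [_ /e].
apply: (plot_comp Vp) => //; last by move=> _ [x [_ Vhx] <-].
by move=> k; apply: Ck_sub (sh k) => x [].
Qed.
Next Obligation.
move=> X Y DX pi pi_surj n U q oU loc; split=> // u Uu.
have [U' [U'u sU' [_ lft]]] := loc u Uu.
have [V [p [Vu sV Vp e]]] := lft u U'u.
by exists V, p; split=> //; exact: subset_trans sU'.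
Qed.

Definition is_vs_diffeology (V : lmodType R) (D : diffeology R V) : Prop :=
  smooth (prod_diffeology D D) D (fun x : V * V => x.1 + x.2) /\
  smooth (prod_diffeology std_diffeology D) D (fun x : R * V => x.1 *: x.2).

(* The finest vector space diffeology on [V] making [f] smooth: the intersection
   of all of them. *)
Definition finest_plot {X : Type} (DX : diffeology R X) (V : lmodType R)
    (f : X -> V) n (U : set 'rV[R]_n) (p : 'rV[R]_n -> V) : Prop :=
  open U /\
  forall D : diffeology R V, is_vs_diffeology D -> smooth DX D f -> plot D U p.

Program Definition finest_vs_diffeology {X : Type} (DX : diffeology R X)
    (V : lmodType R) (f : X -> V) : diffeology R V :=
  @Diffeology R V (finest_plot DX f) _ _ _ _ _.
Next Obligation. by move=> X DX V f n U p []. Qed.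
Next Obligation.
move=> X DX V f n U p q pq [oU Up]; split=> // D vsD sf.
exact: plot_ext pq (Up D vsD sf).
Qed.
Next Obligation. by move=> X DX V f n U x oU; split=> // D _ _; exact: plot_cst. Qed.
Next Obligation.
move=> X DX V f m n U U' p h [oU Up] oU' sh hU; split=> // D vsD sf.
exact: plot_comp (Up D vsD sf) _ _ _.
Qed.
Next Obligation.
move=> X DX V f n U p oU loc; split=> // D vsD sf.
apply: plot_local => // u /loc [U' [U'u sU' [oU' U'p]]].
by exists U'; split=> //; exact: U'p.
Qed.

Lemma finest_vs_diffeologyP {X : Type} (DX : diffeology R X)
    (V : lmodType R) (f : X -> V) :
  [/\ is_vs_diffeology (finest_vs_diffeology DX f),
      smooth DX (finest_vs_diffeology DX f) f &
      forall D, is_vs_diffeology D -> smooth DX D f ->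
        finer (finest_vs_diffeology DX f) D].
Proof.
split; last by move=> D vsD sf n U p [_]; apply.
  split=> n U p [p1 p2].
    split=> [|D vsD sf]; first exact: plot_open p1.
    by case: (vsD) => + _; apply; split; [exact: p1.2|exact: p2.2].
  split=> [|D vsD sf]; first exact: plot_open p2.
  by case: (vsD) => _; apply; split; [exact: p1|exact: p2.2].
move=> n U p Up; split=> [|D _]; first exact: plot_open Up.
exact.
Qed.

End Diffeologies.

Section Dual.
Context {R : realType} {V : lmodType R} (D : diffeology R V).

Definition dual_pred : {pred V -> R^o} :=
  fun f => `[< linear f /\ smooth D std_diffeology f >].

Lemma dual_pred_closed : submod_closed dual_pred.
Proof.
split=> [|a f g /asboolP[lf sf] /asboolP[lg sg]]; apply/asboolP; split.
- by move=> a x y; rewrite scaler0 addr0.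
- by move=> n U p /plot_open oU; exact: plot_cst.
- move=> c x y; rewrite !fctE lf lg !scalerDr !scalerA (mulrC a c).
  by rewrite addrACA.
- move=> n U p Up; have [oU Cf] := sf _ _ _ Up; have [_ Cg] := sg _ _ _ Up.
  split=> // k; apply: (@CkD R _ _ _ _ (cst a * (f \o p)) (g \o p)) => //.
  by apply: CkM => //; exact: Ck_cst.
Qed.

HB.instance Definition _ :=
  GRing.isSubmodClosed.Build R (V -> R^o) dual_pred dual_pred_closed.

Record dual := Dual { dual_fun :> V -> R^o; _ : dual_fun \in dual_pred }.

HB.instance Definition _ := [isSub for dual_fun].
HB.instance Definition _ := [Choice of dual by <:].
HB.instance Definition _ := [SubChoice_isSubLmodule of dual by <:].

End Dual.

Section Dimension.
Context {R : nzRingType}.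

Definition is_basis (V : lmodType R) n (e : 'I_n -> V) : Prop :=
  (forall c : 'I_n -> R, \sum_i c i *: e i = 0 -> forall i, c i = 0) /\
  (forall x : V, exists c : 'I_n -> R, x = \sum_i c i *: e i).

Definition has_dim (V : lmodType R) (n : nat) : Prop :=
  exists e : 'I_n -> V, is_basis e.

End Dimension.

Lemma has_dim_uniq (K : fieldType) (V : lmodType K) m n :
  has_dim V m -> has_dim V n -> m = n.
Proof.
suff le k l (e : 'I_k -> V) (f : 'I_l -> V) : is_basis e -> is_basis f -> (k <= l)%N.
  move=> [e be] [f bf]; apply/eqP.
  by rewrite eqn_leq (le _ _ _ _ be bf) (le _ _ _ _ bf be).
move=> [free_e _] [_ span_f]; have [C eC] := choice (fun i => span_f (e i)).
pose M := \matrix_(i, j) C i j.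
suff /eqP <- : row_free M by exact: rank_leq_col.
rewrite -kermx_eq0; apply/eqP/row_matrixP => r; rewrite row0.
set u := row r _; have uM : u *m M = 0 by rewrite /u -row_mul mulmx_ker row0.
apply/rowP => i; rewrite [RHS]mxE; apply: (free_e (fun i => u 0 i)).
under eq_bigr do rewrite eC scaler_sumr.
rewrite exchange_big /= big1 // => j _.
under eq_bigr do rewrite scalerA.
rewrite -scaler_suml; have /rowP/(_ j) := uM; rewrite !mxE.
under eq_bigr do rewrite [M _ _]mxE.
by move=> ->; rewrite scale0r.
Qed.

Section QuotientModule.
Context {R : pzRingType} {V : lmodType R}.

Definition lspan (A : set V) : {pred V} :=
  fun x => `[< forall S : {pred V},
    submod_closed S -> (forall y, A y -> y \in S) -> x \in S >].

Lemma lspan_closed (A : set V) : submod_closed (lspan A).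
Proof.
split=> [|a x y /asboolP Ax /asboolP Ay]; apply/asboolP => S clS sAS.
  by case: clS.
by have [_] := clS; apply; [exact: Ax|exact: Ay].
Qed.

HB.instance Definition _ (A : set V) :=
  GRing.isSubmodClosed.Build R V (lspan A) (lspan_closed A).

Variable A : set V.

Definition lquot : Type := Quotient.quot (lspan A).

HB.instance Definition _ := GRing.Zmodule.on lquot.

Definition lquot_pi (x : V) : lquot := \pi_(Quotient.quot (lspan A)) x.

Lemma lquot_pi_surj (y : lquot) : exists x, lquot_pi x = y.
Proof. by exists (repr y); exact: reprK. Qed.

Lemma lquot_piP (x y : V) : lquot_pi x = lquot_pi y <-> x - y \in lspan A.
Proof.
rewrite /lquot_pi; split=> [/eqP|xy]; first by rewrite -Quotient.idealrBE.
by apply/eqP; rewrite -Quotient.idealrBE.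
Qed.

Lemma lquot_piD : {morph lquot_pi : x y / x + y}.
Proof. by move=> x y; exact: (@Quotient.pi_add _ (lspan A)). Qed.

Definition lquot_scale (a : R) (x : lquot) : lquot := lquot_pi (a *: repr x).

Lemma lquot_piZ (a : R) (x : V) : lquot_pi (a *: x) = lquot_scale a (lquot_pi x).
Proof.
apply/lquot_piP; rewrite -scalerBr rpredZ //.
by apply/lquot_piP; rewrite /lquot_pi reprK.
Qed.

Lemma lquot_scaleA a b x : lquot_scale a (lquot_scale b x) = lquot_scale (a * b) x.
Proof. by have [{}x <-] := lquot_pi_surj x; rewrite -!lquot_piZ scalerA. Qed.

Lemma lquot_scale1 : left_id 1 lquot_scale.
Proof. by move=> x; have [{}x <-] := lquot_pi_surj x; rewrite -!lquot_piZ scale1r. Qed.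

Lemma lquot_scaleDr : right_distributive lquot_scale +%R.
Proof.
move=> a x y; have [{}x <-] := lquot_pi_surj x; have [{}y <-] := lquot_pi_surj y.
by rewrite -lquot_piD -!lquot_piZ scalerDr lquot_piD.
Qed.

Lemma lquot_scaleDl x : {morph lquot_scale^~ x : a b / a + b}.
Proof.
move=> a b; have [{}x <-] := lquot_pi_surj x.
by rewrite -!lquot_piZ scalerDl lquot_piD.
Qed.

HB.instance Definition _ := GRing.Zmodule_isLmodule.Build R lquot
  lquot_scaleA lquot_scale1 lquot_scaleDr lquot_scaleDl.

End QuotientModule.

Section TensorProduct.
Context {R : realType} (V W : lmodType R).

Definition bilinear_relations : set {freeg (V * W)%type / R} :=
  [set z | (exists (a : R) (v v' : V) (w : W),
             z = << (a *: v + v', w) >> - (a *: << (v, w) >> + << (v', w) >>)) \/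
           (exists (a : R) (v : V) (w w' : W),
             z = << (v, a *: w + w') >> - (a *: << (v, w) >> + << (v, w') >>))].

Definition tensor : lmodType R := lquot bilinear_relations.

Definition tmul (v : V) (w : W) : tensor := lquot_pi bilinear_relations << (v, w) >>.

Definition tensor_diffeology (DV : diffeology R V) (DW : diffeology R W) :
    diffeology R tensor :=
  quotient_diffeology
    (finest_vs_diffeology (prod_diffeology DV DW)
      (fun vw : V * W => << vw >> : {freeg (V * W)%type / R}))
    (@lquot_pi_surj _ _ bilinear_relations).

Lemma tensor_is_vs_diffeology (DV : diffeology R V) (DW : diffeology R W) :
  is_vs_diffeology (tensor_diffeology DV DW).
Proof.
have [[sD sZ] _ _] := finest_vs_diffeologyP (prod_diffeology DV DW)
  (fun vw : V * W => << vw >> : {freeg (V * W)%type / R}).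
split=> n U p [p1 p2].
  split=> [|u Uu]; first exact: plot_open p1.
  have [U1 [q1 [U1u sU1 Uq1 e1]]] := p1.2 u Uu.
  have [U2 [q2 [U2u sU2 Uq2 e2]]] := p2.2 u Uu.
  have oU12 : open (U1 `&` U2) by apply: openI; [exact: plot_open Uq1|exact: plot_open Uq2].
  exists (U1 `&` U2), (fun x => q1 x + q2 x); split=> //.
  - by move=> x [/sU1].
  - apply: (sD _ _ (fun x => (q1 x, q2 x))); split.
      by apply: plot_sub Uq1 => // x [].
    by apply: plot_sub Uq2 => // x [].
  - by move=> x [U1x U2x]; rewrite /= lquot_piD -e1// -e2.
split=> [|u Uu]; first exact: plot_open p1.
have [U2 [q2 [U2u sU2 Uq2 e2]]] := p2.2 u Uu.
have oU2 := plot_open Uq2.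
exists U2, (fun x => (p x).1 *: q2 x); split=> //.
  apply: (sZ _ _ (fun x => ((p x).1, q2 x))); split=> //.
  exact: (plot_sub oU2 sU2 p1).
by move=> x U2x; rewrite /= lquot_piZ -e2.
Qed.

End TensorProduct.

(* Main.v *)
(* Smooth functionals on V (x) W are smooth bilinear forms B on V x W.  Choose a
   basis (e_i) of V^* and vectors (v_i) of V with e_i(v_j) = delta_ij, and
   similarly (f_k) and (w_k) for W.  For fixed w the map B(-, w) is a smooth
   functional on V, hence equals the sum of the B(v_i, w) e_i; for each i the map
   B(v_i, -) is in turn a smooth functional on W.  So
   B = sum_(i,k) B(v_i, w_k) e_i f_k, and the functionals on V (x) W induced by
   the products e_i f_k form a basis, biorthogonal to the v_i (x) w_k. *)
Require Import Defs.
From HB Require Import structures.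
From mathcomp Require Import all_boot all_order all_algebra.
From mathcomp Require Import all_classical reals normedtype.
From mathcomp Require Import freeg.

Set Implicit Arguments.
Unset Strict Implicit.
Unset Printing Implicit Defensive.

Import GRing.Theory.

Local Open Scope classical_set_scope.
Local Open Scope ring_scope.

(** * Linear extension from the free vector space *)

Section FreegLift.
Context {R : nzRingType} {M : lmodType R} {K : choiceType} (f : K -> M).

(** Additivity reduces homogeneity to single terms [<< c *g z >>], which go to [c *: f z]. *)
Lemma fglift_linear : linear (fglift f).
Proof.
have fB := lift_is_additive f.
have f0 : fglift f 0 = 0 by rewrite -(subrr 0) fB subrr.
have fD x y : fglift f (x + y) = fglift f x + fglift f y.
  by rewrite -{1}[y]opprK -[- y]sub0r !fB f0 sub0r opprK.
have f_sum := big_morph (fglift f) fD f0.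
move=> a x y; rewrite fD; congr (_ + _).
rewrite -{1}[x]freeg_sumE -[in RHS](freeg_sumE x) scaler_sumr !f_sum scaler_sumr.
apply: eq_bigr => z _.
have -> : a *: << coeff z x *g z >> = << (a * coeff z x) *g z >>.
  by apply/eqP/freeg_eqP => k; rewrite coeffZ !coeffU mulrA.
by rewrite !liftU scalerA.
Qed.

End FreegLift.

(** * Pulled-back diffeologies and smooth real functions *)

Section Pullback.
Context {R : realType}.

(** These plots form the coarsest diffeology on [X] making [f] smooth. *)
Definition pullback_plot {X Y : Type} (DY : diffeology R Y) (f : X -> Y)
    n (U : set 'rV[R]_n) (p : 'rV[R]_n -> X) : Prop :=
  plot DY U (f \o p).

Program Definition pullback_diffeology {X Y : Type} (DY : diffeology R Y)
    (f : X -> Y) : diffeology R X :=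
  @Diffeology R X (pullback_plot DY f) _ _ _ _ _.
Next Obligation. by move=> X Y DY f n U p /plot_open. Qed.
Next Obligation.
by move=> X Y DY f n U p q pq; apply: plot_ext => u /pq /= ->.
Qed.
Next Obligation. by move=> X Y DY f n U x oU; exact: plot_cst. Qed.
Next Obligation.
by move=> X Y DY f m n U U' p h Up oU' sh hU; exact: (plot_comp Up).
Qed.
Next Obligation. by move=> X Y DY f n U p oU loc; exact: plot_local. Qed.

Lemma smooth_mul {X : Type} (D : diffeology R X) (f g : X -> R) :
  smooth D std_diffeology f -> smooth D std_diffeology g ->
  smooth D std_diffeology (fun x => f x * g x).
Proof.
move=> sf sg n U p Up.
have [oU Cf] := sf _ _ _ Up; have [_ Cg] := sg _ _ _ Up.
by split=> // k; exact: (@CkM _ _ _ _ (f \o p) (g \o p)).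
Qed.

Lemma smooth_add {X : Type} (D : diffeology R X) (f g : X -> R) :
  smooth D std_diffeology f -> smooth D std_diffeology g ->
  smooth D std_diffeology (fun x => f x + g x).
Proof.
move=> sf sg n U p Up.
have [oU Cf] := sf _ _ _ Up; have [_ Cg] := sg _ _ _ Up.
by split=> // k; apply: (@CkD _ _ R^o k U (f \o p) (g \o p)) oU (Cf k) (Cg k).
Qed.

(** Linearity of [f] turns the operations on [V] into addition and multiplication of reals, which
    are smooth. The pullback can then be tested against [finest_vs_diffeology]. *)
Lemma pullback_is_vs_diffeology (V : lmodType R) (f : V -> R^o) :
  linear f -> is_vs_diffeology (pullback_diffeology std_diffeology f).
Proof.
move=> lf; have fD x y : f (x + y) = f x + f y by rewrite -[x]scale1r lf !scale1r.
have f0 : f 0 = 0 by apply: (@addrI _ (f 0)); rewrite -fD !addr0.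
have fZ a x : f (a *: x) = a * f x by rewrite -[a *: x]addr0 lf f0 addr0.
split=> n U p [p1 p2].
  apply: (@plot_ext _ _ _ _ _ (fun u => f (p u).1 + f (p u).2)) => [u _|] /=.
    by rewrite fD.
  apply: (@smooth_add _ (prod_diffeology std_diffeology std_diffeology) fst snd
            _ _ _ U (fun u => (f (p u).1, f (p u).2))).
  - by move=> ? ? ? [].
  - by move=> ? ? ? [].
  - by split.
apply: (@plot_ext _ _ _ _ _ (fun u => (p u).1 * f (p u).2)) => [u _|] /=.
  by rewrite fZ.
apply: (@smooth_mul _ (prod_diffeology std_diffeology std_diffeology) fst snd
          _ _ _ U (fun u => ((p u).1, f (p u).2))).
- by move=> ? ? ? [].
- by move=> ? ? ? [].
- by split.
Qed.

End Pullback.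

(** * Biorthogonal systems in the diffeological dual *)

Section DualBasis.
Context {R : realType} {V : lmodType R} (D : diffeology R V).

Lemma dual_linear (f : dual D) : linear f.
Proof. by case: f => f /= /asboolP[]. Qed.

Lemma dual_smooth (f : dual D) : smooth D std_diffeology f.
Proof. by case: f => f /= /asboolP[]. Qed.

Lemma dual_exists (f : V -> R^o) : linear f -> smooth D std_diffeology f ->
  exists g : dual D, forall x, g x = f x.
Proof.
move=> lf sf; have fP : f \in dual_pred D by apply/asboolP.
by exists (Dual fP).
Qed.

Lemma dual_eqP (f g : dual D) : (forall x, f x = g x) -> f = g.
Proof. by move=> fg; apply: val_inj; apply/funext. Qed.

HB.instance Definition _ (f : dual D) :=
  GRing.isLinear.Build R V R^o *:%R (dual_fun f) (dual_linear f).

Lemma dual_lincombE (I : finType) (c : I -> R) (e : I -> dual D) x :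
  (\sum_i c i *: e i : dual D) x = \sum_i c i * e i x.
Proof. by elim/big_ind2 : _ => //= _ a _ b <- <-. Qed.

(** Biorthogonality gives independence; the second clause gives spanning, with coefficients read off
    at the [v i]. General finite index types allow pairs as indices for the tensor product. *)
Definition dual_system (I : finType) (e : I -> dual D) (v : I -> V) : Prop :=
  (forall i j, e i (v j) = (i == j)%:R) /\
  (forall f : dual D, f = \sum_i f (v i) *: e i).

Lemma sum_delta (I : finType) (c : I -> R) j : \sum_i c i * (i == j)%:R = c j.
Proof.
rewrite (bigD1 j) //= eqxx mulr1 big1 ?addr0 // => i /negbTE ->.
by rewrite mulr0.
Qed.

Lemma dual_system_has_dim (I : finType) (e : I -> dual D) (v : I -> V) :
  dual_system e v -> has_dim (dual D) #|I|.
Proof.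
move=> [ev span]; exists (e \o enum_val); split=> [c c0 i|f].
  pose d k := c (enum_rank k).
  have d0 : \sum_k d k *: e k = 0.
    rewrite -[RHS]c0 (reindex (@enum_val I predT)) /=.
      by apply: eq_bigr => k _; rewrite /d enum_valK.
    exact/onW_bij/enum_val_bij.
  (* Evaluation at [v (enum_val i)] isolates the coefficient [c i]. *)
  have := dual_lincombE d e (v (enum_val i)); rewrite d0 /=.
  under eq_bigr do rewrite ev.
  by rewrite sum_delta /d enum_valK.
exists (fun k => f (v (enum_val k))); rewrite {1}(span f).
by rewrite (reindex (@enum_val I predT)) //=; exact/onW_bij/enum_val_bij.
Qed.

End DualBasis.

(* A biorthogonal family of maximal size spans: a functional g outside the span
   can be taken to vanish on all v_i, and then a suitable v' with g(v') = 1 and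
   e_i(v') = 0 extends the family. *)
Lemma dual_system_exists (R : realType) (V : vectType R) (D : diffeology R V) :
  exists (m : nat) (e : 'I_m -> dual D) (v : 'I_m -> V), dual_system e v.
Proof.
pose P m := `[< exists (e : 'I_m -> dual D) (v : 'I_m -> V),
  forall i j, e i (v j) = (i == j)%:R >].
have P0 : exists m, P m.
  exists 0%N; apply/asboolP; exists (fun=> 0), (fun=> 0) => -[] //.
have Pmax m : P m -> (m <= \dim {:V})%N.
  move=> /asboolP[e [v ev]].
  (* Expanding each [v j] in a basis of [V] factors the identity matrix of size [m] through
     dimension [\dim {:V}]. *)
  apply: (@mulmx1_min R _ _ (\matrix_(i, k) e i (vbasis fullv)`_k)
            (\matrix_(k, j) coord (vbasis fullv) k (v j))).
  apply/matrixP => i j; rewrite !mxE -ev.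
  rewrite [in RHS](coord_vbasis (memvf (v j))) linear_sum.
  by apply: eq_bigr => k _; rewrite !mxE linearZ mulrC.
case: (ex_maxnP P0 Pmax) => m /asboolP[e [v ev]] mmax.
exists m, e, v; split=> // f.
pose g : dual D := f - \sum_i f (v i) *: e i.
have gE x : g x = f x - \sum_i f (v i) * e i x by rewrite -dual_lincombE.
have gv j : g (v j) = 0.
  rewrite gE; under eq_bigr do rewrite ev.
  by rewrite sum_delta subrr.
apply/eqP; rewrite -subr_eq0 -/g; apply/negPn/negP => g0.
clearbody g.
have [x gx] : exists x, g x != 0.
  apply: contrapT => /forallNP gx; case/eqP: g0; apply: dual_eqP => x.
  by have /negP := gx x; rewrite negbK => /eqP.
(* Removing the components along the [v i] kills every [e i] and preserves the value of [g], which
   vanishes on the [v i]; the scalar normalises that value to 1. *)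
pose y := (g x)^-1 *: (x - \sum_i e i x *: v i).
have gy : g y = 1.
  rewrite /y linearZ linearB linear_sum big1 ?subr0 => [|i _].
    exact: mulVf.
  by rewrite linearZ /= gv; exact: mulr0.
have ey i : e i y = 0.
  rewrite /y linearZ linearB linear_sum (bigD1 i) //= big1 ?addr0 => [|j ji].
    by rewrite linearZ /= ev eqxx; rewrite [_ *: 1]mulr1 subrr; exact: mulr0.
  by rewrite linearZ /= ev eq_sym (negbTE ji); exact: mulr0.
suff /mmax : P m.+1 by rewrite ltnn.
apply/asboolP.
(* The new pair [g], [y] takes index 0; the old ones are shifted by one. *)
exists (fun i => oapp e g (unlift ord0 i)), (fun i => oapp v y (unlift ord0 i)).
move=> i j; case: (unliftP ord0 i) => [i'|] ->; case: (unliftP ord0 j) => [j'|] -> /=.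
- by rewrite ev (inj_eq lift_inj).
- by rewrite ey.
- by rewrite gv.
- by rewrite gy.
Qed.

(** * Universal property of the tensor product *)

Section TensorUniversal.
Context {R : realType} {V W : lmodType R}.
Context (DV : diffeology R V) (DW : diffeology R W).

Lemma tmul_linearl (w : W) : linear (fun v : V => tmul v w).
Proof.
move=> a v v'; rewrite /tmul.
rewrite -[_ *: lquot_pi _ _]lquot_piZ -lquot_piD; apply/lquot_piP/asboolP.
by move=> S _; apply; left; exists a, v, v', w.
Qed.

Lemma tmul_linearr (v : V) : linear (fun w : W => tmul v w).
Proof.
move=> a w w'; rewrite /tmul.
rewrite -[_ *: lquot_pi _ _]lquot_piZ -lquot_piD; apply/lquot_piP/asboolP.
by move=> S _; apply; right; exists a, v, w, w'.
Qed.

(** Composing with the generator map gives a global lift, a plot of each intersected diffeology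
    because each makes that map smooth. *)
Lemma tmul_smooth :
  smooth (prod_diffeology DV DW) (tensor_diffeology DV DW)
    (fun x : V * W => tmul x.1 x.2).
Proof.
move=> n U p Up; split=> [|u Uu]; first exact: plot_open Up.
exists U, (fun u => << p u >>); split=> //.
  by split=> [|D _]; [exact: plot_open Up|apply].
by move=> x _ /=; rewrite /tmul -surjective_pairing.
Qed.

(** Every class is a linear combination of pure tensors, read off from the coefficients of a
    representative. *)
Lemma tensor_linear_eq (f g : tensor V W -> R^o) : linear f -> linear g ->
  (forall v w, f (tmul v w) = g (tmul v w)) -> f =1 g.
Proof.
move=> lf lg fg t; have [z <-] := lquot_pi_surj t.
pose F := HB.pack_for {linear tensor V W -> R^o} f
  (GRing.isLinear.Build _ _ _ _ f lf).
pose G := HB.pack_for {linear tensor V W -> R^o} g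
  (GRing.isLinear.Build _ _ _ _ g lg).
rewrite -[f]/(F : _ -> _) -[g]/(G : _ -> _).
pose lpi : {freeg (V * W)%type / R} -> tensor V W :=
  lquot_pi (@bilinear_relations R V W).
have lpi_lin : linear lpi.
  by move=> a x y; rewrite /lpi lquot_piD lquot_piZ.
pose LP := HB.pack_for {linear _ -> tensor V W} lpi
  (GRing.isLinear.Build _ _ _ _ lpi lpi_lin).
rewrite -[lquot_pi _ z]/(LP z) -[z]freeg_sumE !linear_sum.
apply: eq_bigr => -[v w] _.
have -> : << coeff (v, w) z *g (v, w) >> =
    coeff (v, w) z *: << (v, w) >> :> {freeg (V * W)%type / R}.
  by apply/eqP/freeg_eqP => k; rewrite coeffZ !coeffU mul1r.
by rewrite !linearZ; congr (_ *: _); exact: fg.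
Qed.

(** The linear extension [F] of [b] to the free space kills the bilinear relations and so descends
    to the quotient. *)
Lemma tensor_dual_lift (b : V -> W -> R^o) :
    (forall w, linear (b^~ w)) -> (forall v, linear (b v)) ->
    smooth (prod_diffeology DV DW) std_diffeology (fun x => b x.1 x.2) ->
  exists T : dual (tensor_diffeology DV DW), forall v w, T (tmul v w) = b v w.
Proof.
move=> bl br bs; pose F := fglift (fun x : V * W => b x.1 x.2).
have lF : linear F by exact: fglift_linear.
have F1 v w : F << (v, w) >> = b v w by rewrite /F liftU scale1r.
pose FL := HB.pack_for {linear {freeg (V * W)%type / R} -> R^o} F
  (GRing.isLinear.Build _ _ _ _ F lF).
have FB : {morph F : x y / x - y} := linearB FL.
have FD : {morph F : x y / x + y} := linearD FL.
have FZ a z : F (a *: z) = a *: F z := linearZ_LR FL a z.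
have Fker z : z \in lspan (@bilinear_relations R V W) -> F z = 0.
  (* The kernel of [F] is a submodule, so it contains the span once it contains the relations. *)
  move=> /asboolP /(_ [pred x | F x == 0]) Fz; apply/eqP/Fz.
    split=> [|a x y /eqP Fx /eqP Fy]; apply/eqP; first exact: (linear0 FL).
    by rewrite lF Fx Fy scaler0 addr0.
  move=> _ [[a [v [v' [w ->]]]]|[a [v [w [w' ->]]]]]; apply/eqP.
    by rewrite FB FD FZ !F1 bl subrr.
  by rewrite FB FD FZ !F1 br subrr.
pose T (t : tensor V W) : R^o := F (repr t).
have Tpi z : T (lquot_pi _ z) = F z.
  apply/eqP; rewrite -subr_eq0 -FB; apply/eqP/Fker.
  by apply/lquot_piP; rewrite {1}/lquot_pi reprK.
have lT : linear T.
  move=> a s t; have [{}s <-] := lquot_pi_surj s; have [{}t <-] := lquot_pi_surj t.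
  by rewrite -[_ *: _]lquot_piZ -lquot_piD !Tpi lF.
have sT : smooth (tensor_diffeology DV DW) std_diffeology T.
  move=> n U q [oU lft]; apply: plot_local => // u /lft[U' [p [U'u sU' [_ Up] qp]]].
  exists U'; split=> //.
  apply: (@plot_ext _ _ _ _ _ (F \o p)) => [x /qp /= ->|]; first by rewrite Tpi.
  (* Being a plot for the pullback along [F] says that [F \o p] is smooth; on generators [F] is the
     smooth map [b]. *)
  apply: (Up (pullback_diffeology std_diffeology F)).
    exact: pullback_is_vs_diffeology.
  move=> k U1 p1 Up1; apply: (plot_ext _ (bs _ _ _ Up1)) => x _ /=.
  by rewrite -F1 -surjective_pairing.
have [g gT] := dual_exists lT sT; exists g => v w.
by rewrite gT Tpi F1.
Qed.

Lemma tensor_dual_system (I J : finType) (e : I -> dual DV) (v : I -> V)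
    (f : J -> dual DW) (w : J -> W) :
    dual_system e v -> dual_system f w ->
  exists T : I * J -> dual (tensor_diffeology DV DW),
    dual_system T (fun k => tmul (v k.1) (w k.2)).
Proof.
move=> [ev espan] [fw fspan].
have lift k : exists T : dual (tensor_diffeology DV DW),
    forall x y, T (tmul x y) = e k.1 x * f k.2 y.
  apply: (tensor_dual_lift (b := fun x y => e k.1 x * f k.2 y)).
  - by move=> y a x x'; rewrite linearP mulrDl scalerAl.
  - by move=> x a y y'; rewrite linearP mulrDr scalerAr.
  - apply: smooth_mul => n U p [p1 p2]; exact: dual_smooth.
have [T TE] := choice lift; exists T; split=> [[i k] [j l]|S].
  by rewrite TE ev fw xpair_eqE -mulnb natrM.
(* Slices of [S] are smooth because pairing a plot with a constant is a plot of the product. *)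
have SV y : exists g : dual DV, forall x, g x = S (tmul x y).
  apply: dual_exists => [a x x'|n U p Up].
    by rewrite tmul_linearl linearP.
  apply: (@dual_smooth _ _ _ S _ _ (fun u => tmul (p u) y)).
  apply: (@tmul_smooth _ _ (fun u => (p u, y))).
  by split=> //; apply: plot_cst; exact: plot_open Up.
have SW x : exists g : dual DW, forall y, g y = S (tmul x y).
  apply: dual_exists => [a y y'|n U p Up].
    by rewrite tmul_linearr linearP.
  apply: (@dual_smooth _ _ _ S _ _ (fun u => tmul x (p u))).
  apply: (@tmul_smooth _ _ (fun u => (x, p u))).
  by split=> //; apply: plot_cst; exact: plot_open Up.
apply: dual_eqP; apply: tensor_linear_eq; try exact: dual_linear.
move=> x y; rewrite dual_lincombE.
under eq_bigr do rewrite TE.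
(* Expand first in [x] with [y] fixed, then in [y] at each [v i]. *)
rewrite -(pair_bigA _ (fun i j => S (tmul (v i) (w j)) * (e i x * f j y))) /=.
have [g gE] := SV y; rewrite -gE (espan g) dual_lincombE.
apply: eq_bigr => i _; rewrite gE.
have [h hE] := SW (v i); rewrite -hE (fspan h) dual_lincombE mulr_suml.
by apply: eq_bigr => j _; rewrite hE mulrAC mulrA.
Qed.

End TensorUniversal.

Theorem theorem1p14 (R : realType) (V W : vectType R)
    (DV : diffeology R V) (DW : diffeology R W)
    (hV : is_vs_diffeology DV) (hW : is_vs_diffeology DW) :
  exists m n : nat,
    [/\ has_dim (dual DV) m, has_dim (dual DW) n &
        has_dim (dual (tensor_diffeology DV DW)) (m * n)].
Proof.
have [m [e [v ev]]] := dual_system_exists DV.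
have [n [f [w fw]]] := dual_system_exists DW.
(* The index type is ['I_m * 'I_n], whose cardinality is the product of the dimensions. *)
have [T Tvw] := tensor_dual_system ev fw.
exists m, n; split.
- by have := dual_system_has_dim ev; rewrite card_ord.
- by have := dual_system_has_dim fw; rewrite card_ord.
- by have := dual_system_has_dim Tvw; rewrite card_prod !card_ord.
Qed.
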